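(* Let $f=\frac1N\sum_{i=1}^N f_i$ with minimizer $x^*$, where each $f_i:\mathbb{R}^d\to\mathbb{R}$ is convex and $L$-smooth and $f$ is $\mu$-strongly convex; let $\kappa=L/\mu$. Suppose $0<\eta<\frac{1}{4L}$ and $TK=Q\le \tilde n m$. Then the output $\tilde x^K$ of the DSVRG algorithm (described in the context) run with step length $\eta$, $T$ iterations per stage, $K$ stages, and initial solution $\tilde x^0$ satisfies $$\mathbb{E}\left[f(\tilde x^{K})-f(x^* )\right]\leq\left(\frac{1}{\mu\eta(1-4L\eta)T}+\frac{4L\eta(T+1)}{(1-4L\eta)T}\right)^{K}\left[f(\tilde x^0)-f(x^* )\right].$$ In particular, when $\eta=\frac{1}{16L}$, $T=96\kappa$ and $TK=Q\le\tilde n m$, the DSVRG algorithm needs $$K=\frac{1}{\log(9/8)}\log\left(\frac{f(\tilde x^0)-f(x^* )}{\epsilon}\right)$$ stages to find an $\epsilon$-optimal solution; that is, with this $K$, $\mathbb{E}[f(\tilde x^K)-f(x^* )]\le\epsilon$.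
   Context: Setting. $N=mn$ with positive integers $m\ll n$; $m$ is the number of machines. Norms are Euclidean. $f_i$ is $L$-smooth if it is differentiable with $\|\nabla f_i(x)-\nabla f_i(y)\|\le L\|x-y\|$ for all $x,y$. The convex function $f=\frac1N\sum_i f_i$ is $\mu$-strongly convex ($\mu>0$): $\|\nabla f(x)-\nabla f(y)\|\ge\mu\|x-y\|$ for all $x,y$. $x^*$ is the unique minimizer of $f$. A random $\hat x$ is $\epsilon$-optimal if $\mathbb{E}[f(\hat x)-f(x^* )]\le\epsilon$. Each machine can store at most $C$ of the functions, with $n<C<N$, and $\tilde n:=C-n\ge cn$ for a universal constant $c>0$. DSVRG algorithm. Inputs: $\tilde x^0\in\mathbb{R}^d$, $\eta$, positive integers $T,K$, and $Q=TK$. (1) Data allocation: produce a random partition $S_1,\dots,S_m$ of $[N]=\{1,\dots,N\}$ with $|S_j|=n$, and indices $r_1,\dots,r_Q$ that are i.i.d. uniform on $[N]$. With $J=\lceil Q/\tilde n\rceil$, define multi-sets $R_j=\{r_{(j-1)\tilde n+1},\dots,r_{j\tilde n}\}$ for $j<J$, $R_J=\{r_{(J-1)\tilde n+1},\dots,r_Q\}$, and $R_j=\emptyset$ for $j>J$. Machine $j$ stores $\{f_i: i\in S_j\cup R_j\}$. Set the active machine index $k\leftarrow1$. (2) For each stage $\ell=0,1,\dots,K-1$: the machines compute in parallel $h_j^\ell=\sum_{i\in S_j}\nabla f_i(\tilde x^\ell)$, and the center forms $h^\ell=\frac1N\sum_{j=1}^m h_j^\ell=\nabla f(\tilde x^\ell)$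 and sends it to machine $k$. Then the single-stage procedure SS-SVRG is run: set $x_0=\tilde x^\ell$, $\bar x_0=0$; for $t=0,\dots,T-1$, machine $k$ samples an element $i$ from $R_k$, sets $$x_{t+1}=x_t-\eta\left(\nabla f_i(x_t)-\nabla f_i(\tilde x^\ell)+h^\ell\right),\qquad \bar x_{t+1}=\frac{x_{t+1}+t\bar x_t}{t+1},$$ and removes (one copy of) $i$ from $R_k$; if $R_k$ becomes empty, $x_{t+1},\bar x_{t+1}$ are sent to machine $k+1$ and $k\leftarrow k+1$. Finally $\tilde x^{\ell+1}=\bar x_T$ (the updated multi-sets and $k$ carry over to the next stage). (3) Output $\tilde x^K$. The values prescribed for $T$ and $K$ are understood to be rounded up to integers. *)

(* Defs.v *)
From mathcomp Require Import all_boot all_order all_algebra.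
From mathcomp Require Import all_classical all_reals all_analysis.

Set Implicit Arguments.
Unset Strict Implicit.
Unset Printing Implicit Defensive.

Import Order.TTheory GRing.Theory Num.Theory.
Import numFieldNormedType.Exports.

Local Open Scope ring_scope.

(* The library norm on 'rV[R]_d is the sup norm; it only serves for the
   topology underlying [differentiable]. *)
Definition norm2 (R : realType) (d : nat) (x : 'rV[R]_d) : R :=
  Num.sqrt (\sum_(i < d) x 0 i ^+ 2).

Definition grad (R : realType) (d : nat) (f : 'rV[R]_d -> R) (x : 'rV[R]_d) :
    'rV[R]_d :=
  \row_(i < d) ('D_(delta_mx 0 i) f x : R).

Definition convex_fun (R : realType) (d : nat) (f : 'rV[R]_d -> R) : Prop :=
  convex_function [set: convex_lmodType 'rV[R]_d] f.

Definition smooth (R : realType) (d : nat) (L : R) (f : 'rV[R]_d -> R) : Prop :=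
  (forall x, differentiable f x) /\
  (forall x y, norm2 (grad f x - grad f y) <= L * norm2 (x - y)).

Definition strongly_convex (R : realType) (d : nat) (mu : R)
    (f : 'rV[R]_d -> R) : Prop :=
  [/\ 0 < mu, convex_fun f &
      forall x y, mu * norm2 (x - y) <= norm2 (grad f x - grad f y)].

Definition favg (R : realType) (d N : nat) (f : 'I_N -> 'rV[R]_d -> R)
    (x : 'rV[R]_d) : R :=
  N%:R^-1 * \sum_(i < N) f i x.

(* Finitely supported laws, as lists of weighted outcomes: all the randomness of
   the algorithm is finite.  Outcomes may be repeated, their weights add up. *)
Definition dist (R : realType) (A : Type) : Type := seq (R * A).

Definition dret (R : realType) (A : Type) (a : A) : dist R A := [:: (1, a)].

Definition dbind (R : realType) (A B : Type) (p : dist R A)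
    (q : A -> dist R B) : dist R B :=
  [seq (wa.1 * wb.1, wb.2) | wa <- p, wb <- q wa.2].

Notation "'sample' x 'from' p ';;' q" := (dbind p (fun x => q))
  (at level 200, x pattern, p at level 100, q at level 200,
   format "'sample'  x  'from'  p  ';;' '//' q").

Definition expect (R : realType) (A : Type) (p : dist R A) (F : A -> R) : R :=
  \sum_(wa <- p) wa.1 * F wa.2.

(* Uniform over positions, hence with multiplicity when [s] is a multi-set. *)
Definition dunif (R : realType) (A : Type) (s : seq A) : dist R A :=
  [seq ((size s)%:R^-1, a) | a <- s].

Fixpoint diid (R : realType) (A : Type) (p : dist R A) (q : nat) :
    dist R (seq A) :=
  if q is q'.+1 then
    sample a from p ;;
    sample s from diid p q' ;;
    dret R (a :: s)
  else dret R [::].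

Fixpoint dfor (R : realType) (I S : Type) (body : I -> S -> dist R S)
    (l : seq I) (s : S) : dist R S :=
  if l is i :: l' then
    sample s' from body i s ;;
    dfor body l' s'
  else dret R s.

Definition eps_optimal (R : realType) (d : nat) (F : 'rV[R]_d -> R)
    (xs : 'rV[R]_d) (eps : R) (p : dist R 'rV[R]_d) : Prop :=
  expect p (fun x => F x - F xs) <= eps.

(* [part j] is stored by machine [j]; injectivity makes distinct machines have
   distinct, hence disjoint, parts. *)
Definition is_allocation (m n N : nat) (part : {ffun 'I_m -> {set 'I_N}}) :
    bool :=
  [&& finset.partition [set part j | j : 'I_m]%SET [set: 'I_N]%SET,
      injectiveb part &
      [forall j, #|part j| == n]].

Definition random_partition (R : realType) (m n N : nat) :
    dist R {ffun 'I_m -> {set 'I_N}} :=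
  dunif R [seq part <- enum {ffun 'I_m -> {set 'I_N}} | is_allocation n part].

(* Multi-sets are lists.  Machines are numbered from 0; [take] and [drop]
   truncate, so that the last non-empty block may be shorter than [nt] and the
   blocks of the remaining machines are empty. *)
Definition sample_blocks (m nt N : nat) (r : seq 'I_N) : seq (seq 'I_N) :=
  mkseq (fun j => take nt (drop (j * nt) r)) m.

Record machines (N : nat) := Machines {
  active : nat;
  blocks : seq (seq 'I_N)
}.

(* The active machine samples an element of its block and removes one copy of
   it; the next machine becomes active if the block is exhausted.  Sampling from
   an empty block yields the null law; this never happens within the first
   [size r] draws from [sample_blocks m nt r] when [size r <= nt * m]. *)
Definition draw (R : realType) (N : nat) (M : machines N) :
    dist R ('I_N * machines N) :=
  let k := active M in
  let Rk := nth [::] (blocks M) k in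
  sample i from dunif R Rk ;;
  let Rk' := rem i Rk in
  dret R (i, Machines (if nilp Rk' then k.+1 else k)
                      (set_nth [::] (blocks M) k Rk')).

Section DSVRG.
Variables (R : realType) (d m n N nt : nat).
Variables (f : 'I_N -> 'rV[R]_d -> R) (eta : R).

(* The state is (x_t, xbar_t, machines). *)
Definition svrg_iter (xt h : 'rV[R]_d) (t : nat)
    (s : 'rV[R]_d * 'rV[R]_d * machines N) :
    dist R ('rV[R]_d * 'rV[R]_d * machines N) :=
  let: (x, xbar, M) := s in
  sample (i, M') from draw R M ;;
  let x' := x - eta *: (grad (f i) x - grad (f i) xt + h) in
  let xbar' := t.+1%:R^-1 *: (x' + t%:R *: xbar) in
  dret R (x', xbar', M').

Definition ss_svrg (T : nat) (xt h : 'rV[R]_d) (M : machines N) :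
    dist R ('rV[R]_d * machines N) :=
  sample (_, xbar, M') from dfor (svrg_iter xt h) (iota 0 T) (xt, 0, M) ;;
  dret R (xbar, M').

Definition full_gradient (part : {ffun 'I_m -> {set 'I_N}}) (xt : 'rV[R]_d) :
    'rV[R]_d :=
  N%:R^-1 *: \sum_(j < m) \sum_(i in part j) grad (f i) xt.

Definition dsvrg_stage (T : nat) (part : {ffun 'I_m -> {set 'I_N}}) (l : nat)
    (s : 'rV[R]_d * machines N) : dist R ('rV[R]_d * machines N) :=
  let: (xt, M) := s in
  ss_svrg T xt (full_gradient part xt) M.

(* The law of the output; [nt] is the number C - n of sampled functions that a
   machine can store besides its part. *)
Definition dsvrg (T K : nat) (x0 : 'rV[R]_d) : dist R 'rV[R]_d :=
  sample part from random_partition R m n N ;;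
  sample r from diid (dunif R (enum 'I_N)) (T * K) ;;
  sample (xt, _) from
    dfor (dsvrg_stage T part) (iota 0 K)
      (x0, Machines 0 (sample_blocks m nt r)) ;;
  dret R xt.

End DSVRG.

(* Main.v *)
Require Import Defs.
From mathcomp Require Import all_boot all_order all_algebra.
From mathcomp Require Import all_classical all_reals all_analysis.
From mathcomp Require Import ring lra zify.
Import Order.TTheory GRing.Theory Num.Theory.
Import numFieldNormedType.Exports.

Set Implicit Arguments.
Unset Strict Implicit.
Unset Printing Implicit Defensive.

Local Open Scope ring_scope.

(** The proof is the SVRG recursion of Johnson and Zhang.  Write
    D(x) = f(x) - f(xs), with xs the minimizer, c = 2 eta (1 - 2 L eta) and
    B = 4 L eta^2 D(xt) for the reference point xt of a stage.  When the sampled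
    indices are i.i.d. uniform, the variance bound
    E|v|^2 <= 4 L (D(x_t) + D(xt)) makes the potential
    c t D(xbar_t) + |x_t - xs|^2 - c D(x_t) grow by at most B per iteration in
    expectation, and at t = T it dominates c T D(xbar_T) because c L / 2 <= 1.

    Quadratic growth with the sharp constant mu has to be derived from the
    expansion property |grad f(x) - grad f(y)| >= mu |x - y|.  If f is m-strongly
    convex with m < mu, cocoercivity of the gradient of f - m |.|^2 / 2 improves m
    to m + (mu - m)^2 / (L - m), so the supremum of the admissible m is mu.

    Sampling without replacement from the blocks R_j yields i.i.d. uniform
    indices: the element removed from an i.i.d. block is independent of the
    multi-set that is left. *)

(** * Euclidean inner product and Cauchy-Schwarz *)

Definition dot (R : realType) (d : nat) (u v : 'rV[R]_d) : R :=
  \sum_(i < d) u 0 i * v 0 i.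

Section Dot.
Context {R : realType} {d : nat}.
Implicit Types (u v w : 'rV[R]_d) (a : R).

Lemma dotC u v : dot u v = dot v u.
Proof. by apply: eq_bigr => i _; rewrite mulrC. Qed.

Lemma dotDl u v w : dot (u + v) w = dot u w + dot v w.
Proof. by rewrite -big_split; apply: eq_bigr => i _; rewrite !mxE mulrDl. Qed.

Lemma dotZl a u v : dot (a *: u) v = a * dot u v.
Proof. by rewrite mulr_sumr; apply: eq_bigr => i _; rewrite !mxE mulrA. Qed.

Lemma dotDr u v w : dot u (v + w) = dot u v + dot u w.
Proof. by rewrite dotC dotDl !(dotC u). Qed.

Lemma dotZr a u v : dot u (a *: v) = a * dot u v.
Proof. by rewrite dotC dotZl dotC. Qed.

Lemma dotNl u v : dot (- u) v = - dot u v.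
Proof. by rewrite -scaleN1r dotZl mulN1r. Qed.

Lemma dotNr u v : dot u (- v) = - dot u v.
Proof. by rewrite -scaleN1r dotZr mulN1r. Qed.

Definition dot_linE := (dotDl, dotDr, dotNl, dotNr, dotZl, dotZr).

Lemma dot_sumr (I : Type) (s : seq I) (F : I -> 'rV[R]_d) u :
  dot u (\sum_(i <- s) F i) = \sum_(i <- s) dot u (F i).
Proof.
elim: s => [|i s IHs]; last by rewrite !big_cons dotDr IHs.
by rewrite !big_nil -[0](scale0r 0) dotZr mul0r.
Qed.

Lemma dot_ge0 u : 0 <= dot u u.
Proof. by apply: sumr_ge0 => i _; rewrite -expr2 sqr_ge0. Qed.

Lemma dot_eq0 u : dot u u = 0 -> u = 0.
Proof.
move=> u0; apply/rowP => i; rewrite mxE.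
have /psumr_eq0P/(_ u0 i isT)/eqP : forall i, true -> 0 <= u 0 i * u 0 i.
  by move=> j _; rewrite -expr2 sqr_ge0.
by rewrite -expr2 sqrf_eq0 => /eqP.
Qed.

Lemma sqr_norm2 u : norm2 u ^+ 2 = dot u u.
Proof.
rewrite sqr_sqrtr; last by apply: sumr_ge0 => i _; rewrite sqr_ge0.
by apply: eq_bigr => i _; rewrite expr2.
Qed.

Lemma norm2_ge0 u : 0 <= norm2 u.
Proof. exact: sqrtr_ge0. Qed.

(** Cauchy-Schwarz: with a = |u| and b = |v| both positive, expand |b u - a v|^2 >= 0 and divide by
    a b. *)
Lemma dot_le_norm2 u v : dot u v <= norm2 u * norm2 v.
Proof.
have := norm2_ge0 u; have := norm2_ge0 v.
move: (sqr_norm2 u) (sqr_norm2 v); set a := norm2 u; set b := norm2 v.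
move=> uE vE b0 a0.
have [a_eq0|a_neq0] := eqVneq a 0.
  have -> : u = 0 by apply: dot_eq0; rewrite -uE a_eq0 expr0n.
  by rewrite -[0](scale0r 0) dotZl mul0r mulr_ge0.
have [b_eq0|b_neq0] := eqVneq b 0.
  have -> : v = 0 by apply: dot_eq0; rewrite -vE b_eq0 expr0n.
  by rewrite -[0](scale0r 0) dotZr mul0r mulr_ge0.
have ab_gt0 : 0 < a * b by rewrite mulr_gt0 // lt0r ?a_neq0 ?b_neq0.
have := dot_ge0 (b *: u - a *: v).
rewrite !dot_linE -uE -vE (dotC v u) => h.
rewrite -subr_ge0 -(pmulr_rge0 _ ab_gt0); nra.
Qed.

End Dot.

(** * First-order inequalities for convex and smooth functions *)

(** First-order form of convexity: [m = 0] gives tangent minorants, [m > 0] gives m-strong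
    convexity. *)
Definition lower_bound_at_grad (R : realType) (d : nat) (m : R)
    (f : 'rV[R]_d -> R) : Prop :=
  forall x y, f x + dot (grad f x) (y - x) + m / 2 * dot (y - x) (y - x) <= f y.

Definition upper_bound_at_grad (R : realType) (d : nat) (L : R)
    (f : 'rV[R]_d -> R) : Prop :=
  forall x y, f y <= f x + dot (grad f x) (y - x) + L / 2 * dot (y - x) (y - x).

Section GradientInequalities.
Context {R : realType} {d : nat}.
Implicit Types (f : 'rV[R]_d -> R) (x y v : 'rV[R]_d).

Lemma derive_grad f x v : differentiable f x -> 'D_v f x = dot (grad f x) v.
Proof.
move=> df; rewrite deriveE// {1}(row_sum_delta v) linear_sum.
by apply: eq_bigr => i _; rewrite linearZ /= mxE deriveE// mulrC.
Qed.

Lemma is_derive_line f x v (t : R) : (forall z, differentiable f z) ->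
  is_derive t (1 : R) (fun s : R => f (x + s *: v)) (dot (grad f (x + t *: v)) v).
Proof.
move=> df; rewrite -derive_grad//.
have quotE : (fun h : R => h^-1 *: (((fun s : R => f (x + s *: v)) \o shift t)
      (h *: 1) - f (x + t *: v))) =
    (fun h : R => h^-1 *: ((f \o shift (x + t *: v)) (h *: v)
      - f (x + t *: v))).
  apply/funext => h /=; congr (_ *: (f _ - _)).
  by rewrite scalerDl addrCA [h *: 1]mulr1.
split; first by rewrite /derivable quotE; exact: diff_derivable.
by rewrite /derive quotE.
Qed.

Lemma convex_fun_le f x y (t : R) : convex_fun f -> 0 <= t <= 1 ->
  f (t *: x + (1 - t) *: y) <= t * f x + (1 - t) * f y.
Proof.
move=> cf /andP[t0 t1].
by have := cf (Itv01 t0 t1) x y; rewrite !inE; apply.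
Qed.

(** Divide the chord inequality on [x, y] by the step h and let h tend to 0 from the right. *)
Lemma convex_lower f : (forall x, differentiable f x) -> convex_fun f ->
  lower_bound_at_grad 0 f.
Proof.
move=> df cf x y; rewrite mul0r mul0r addr0 -derive_grad// -lerBrDl.
have cvg_quot : ((fun h : R => h^-1 *: ((f \o shift x) (h *: (y - x)) - f x))
    @ (0^'+)%classic --> ('D_(y - x) f x : R))%classic.
  by apply: cvg_dnbhs_at_right; exact: diff_derivable.
apply: (cvgr_to_le cvg_quot); near=> h.
have h0 : 0 < h by near: h; exact: nbhs_right_gt.
have h1 : h <= 1 by near: h; exact: nbhs_right_le.
rewrite /= -[X in X <= _]/(h^-1 * _) ler_pdivrMl//.
have := @convex_fun_le f y x h cf; rewrite (ltW h0) h1 => /(_ isT).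
suff -> : h *: (y - x) + x = h *: y + (1 - h) *: x by lra.
by rewrite scalerBr scalerBl scale1r -addrA [- _ + x]addrC.
Unshelve. all: by end_near.
Qed.

(** Descent lemma, by the mean value theorem instead of an integral: [psi] is f along the segment
    minus the quadratic bound, and its derivative is nonpositive on ]0, 1[. *)
Lemma smooth_upper (L : R) f : smooth L f -> upper_bound_at_grad L f.
Proof.
move=> [df lipf] x y.
suff {y} /(_ (y - x)) : forall v,
    f (x + v) <= f x + dot (grad f x) v + L / 2 * dot v v.
  by rewrite [x + _]addrC subrK.
move=> v.
pose psi (t : R) := f (x + t *: v) - t * dot (grad f x) v
                    - L / 2 * dot v v * t ^+ 2.
pose dpsi (t : R) := dot (grad f (x + t *: v)) v - dot (grad f x) v
                     - L * dot v v * t.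
have psiD (t : R) : is_derive t (1 : R) psi (dpsi t).
  have fD := is_derive_line x v t df.
  by apply: is_derive_eq; rewrite /dpsi /GRing.scale /=; field.
have psi_cont : {within `[0, 1], continuous psi}%classic.
  apply: continuous_subspaceT => t.
  by apply/differentiable_continuous/derivable1_diffP; exact: ex_derive.
have [c] := MVT ltr01 (fun t _ => psiD t) psi_cont.
rewrite in_itv /= => /andP[c0 c1] psiE.
suff : dpsi c <= 0.
  move: psiE; rewrite /psi scale0r addr0 scale1r.
  by rewrite subr0 mulr1 mul1r mul0r expr1n expr0n /=; lra.
(* Stated for the true displacement [c *: v], so that the Lipschitz bound applies; the factor
   [c > 0] is divided out afterwards. *)
have : dot (grad f (x + c *: v) - grad f x) (c *: v) <= L * dot (c *: v) (c *: v).
  apply: le_trans (dot_le_norm2 _ _) _; rewrite -sqr_norm2 expr2 mulrA.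
  apply: ler_wpM2r; first exact: norm2_ge0.
  by have := lipf (x + c *: v) x; rewrite addrAC subrr add0r.
rewrite !dot_linE /dpsi => h.
by rewrite -(pmulr_rle0 _ c0); lra.
Qed.

End GradientInequalities.

(** * Expectations under finite laws, and i.i.d. samples *)

Section Expectation.
Context {R : realType}.

Lemma expect_dret (A : Type) (a : A) (F : A -> R) : expect (dret R a) F = F a.
Proof. by rewrite /expect big_seq1 mul1r. Qed.

Lemma expect_dbind (A B : Type) (p : dist R A) (q : A -> dist R B)
    (F : B -> R) :
  expect (dbind p q) F = expect p (fun a => expect (q a) F).
Proof.
rewrite /expect /dbind big_allpairs_dep; apply: eq_bigr => wa _ /=.
by rewrite mulr_sumr; apply: eq_bigr => wb _; rewrite mulrA.
Qed.

Lemma expect_dfor_cons (I S : Type) (body : I -> S -> dist R S) i l s H :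
  expect (dfor body (i :: l) s) H =
  expect (body i s) (fun s' => expect (dfor body l s') H).
Proof. exact: expect_dbind. Qed.

Lemma expect_dunif (A : Type) (s : seq A) (F : A -> R) :
  expect (dunif R s) F = (size s)%:R^-1 * \sum_(a <- s) F a.
Proof. by rewrite /expect /dunif big_map mulr_sumr. Qed.

Lemma expectD (A : Type) (p : dist R A) (F G : A -> R) :
  expect p (fun a => F a + G a) = expect p F + expect p G.
Proof. by rewrite -big_split; apply: eq_bigr => wa _; rewrite mulrDr. Qed.

Lemma expectZ (A : Type) (p : dist R A) (c : R) (F : A -> R) :
  expect p (fun a => c * F a) = c * expect p F.
Proof. by rewrite mulr_sumr; apply: eq_bigr => wa _; rewrite mulrCA. Qed.

Lemma expect_sum (A : Type) (p : dist R A) (I : Type) (s : seq I)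
    (F : I -> A -> R) :
  expect p (fun a => \sum_(i <- s) F i a) = \sum_(i <- s) expect p (F i).
Proof.
rewrite /expect; under eq_bigr do rewrite mulr_sumr.
by rewrite exchange_big.
Qed.

Lemma eq_expect (A : Type) (p : dist R A) (F G : A -> R) :
  F =1 G -> expect p F = expect p G.
Proof. by move=> FG; apply: eq_bigr => wa _; rewrite FG. Qed.

Lemma exchange_expect (A B : Type) (p : dist R A) (q : dist R B)
    (F : A -> B -> R) :
  expect p (fun a => expect q (F a)) = expect q (fun b => expect p (F^~ b)).
Proof.
rewrite /expect; under eq_bigr do rewrite mulr_sumr.
rewrite exchange_big; apply: eq_bigr => wb _; rewrite mulr_sumr.
by apply: eq_bigr => wa _; rewrite mulrCA.
Qed.

(** [0 <= B] settles the empty list, whose uniform law is null and has expectation 0. *)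
Lemma expect_dunif_le (A : eqType) (s : seq A) (F : A -> R) (B : R) :
  0 <= B -> (forall a, a \in s -> F a <= B) -> expect (dunif R s) F <= B.
Proof.
move=> B0 FB; rewrite expect_dunif.
have [->|s_neq0] := eqVneq s [::]; first by rewrite big_nil mulr0.
rewrite ler_pdivrMl; last by rewrite ltr0n lt0n size_eq0.
have -> : (size s)%:R * B = \sum_(a <- s) B.
  by rewrite big_const_seq count_predT iter_addr_0 mulr_natl.
by rewrite big_seq [leRHS]big_seq; exact: ler_sum.
Qed.

Section Iid.
Context {A : Type} (p : dist R A).

Lemma expect_diidS q (F : seq A -> R) :
  expect (diid p q.+1) F = expect p (fun a => expect (diid p q) (fun s => F (a :: s))).
Proof.
rewrite expect_dbind; apply: eq_expect => a; rewrite expect_dbind.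
by apply: eq_expect => s; rewrite expect_dret.
Qed.

Lemma eq_expect_diid q (F G : seq A -> R) :
  (forall s, size s = q -> F s = G s) ->
  expect (diid p q) F = expect (diid p q) G.
Proof.
elim: q F G => [|q IHq] F G FG; first by rewrite !expect_dret FG.
rewrite !expect_diidS; apply: eq_expect => a.
by apply: IHq => s sq; apply: FG; rewrite /= sq.
Qed.

Lemma expect_diid_cat a b (F : seq A -> R) :
  expect (diid p (a + b)) F =
  expect (diid p a) (fun s => expect (diid p b) (fun t => F (s ++ t))).
Proof.
elim: a F => [|a IHa] F; first by rewrite add0n expect_dret.
by rewrite addSn !expect_diidS; apply: eq_expect => x; rewrite IHa.
Qed.

Lemma expect_diid_cst q (c : R) : (forall c, expect p (fun=> c) = c) ->
  expect (diid p q) (fun=> c) = c.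
Proof.
move=> p1; elim: q => [|q IHq]; first by rewrite expect_dret.
by rewrite expect_diidS; under eq_expect do rewrite IHq.
Qed.

End Iid.

(* Removing a uniformly chosen element from an i.i.d. sample leaves an element
   that is independent of the remaining i.i.d. sample.  As [rem] removes the
   first occurrence, this holds for the remaining multi-set only, whence the
   symmetry hypothesis. *)
Lemma expect_diid_rem (A : eqType) (p : dist R A) q (G : A -> seq A -> R) :
    (forall a s t, size s = q -> perm_eq s t -> G a s = G a t) ->
  expect (diid p q.+1) (fun s => \sum_(a <- s) G a (rem a s)) =
  q.+1%:R * expect p (fun a => expect (diid p q) (G a)).
Proof.
elim: q G => [|q IHq] G symG.
  rewrite mul1r expect_diidS; apply: eq_expect => a.
  by rewrite !expect_dret big_seq1 /= eqxx.
have remE a s : size s = q.+1 ->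
    \sum_(b <- a :: s) G b (rem b (a :: s)) =
    G a s + \sum_(b <- s) G b (a :: rem b s).
  move=> ss; rewrite big_cons /= eqxx; congr (_ + _).
  rewrite big_seq [RHS]big_seq; apply: eq_bigr => b bs.
  case: eqVneq => [->|//]; apply: symG => //.
  by apply: perm_to_rem.
rewrite expect_diidS.
under eq_expect => a.
  rewrite (@eq_expect_diid _ p q.+1 _ _ (remE a)) expectD.
  rewrite (IHq (fun b s => G b (a :: s))); last first.
    by move=> b s t ss st; apply: symG; rewrite /= ?ss// perm_cons.
  over.
(* The head [a] contributes one copy of the right-hand expectation; the induction contributes q + 1
   more once the draws of [a] and [b] are exchanged. *)
rewrite expectD expectZ [X in _ + _ * X]exchange_expect.
rewrite -[in RHS]natr1 mulrDl mul1r [RHS]addrC.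
by congr (_ + _ * _); apply: eq_expect => b; rewrite expect_diidS.
Qed.

End Expectation.

(** * Draws without replacement from the blocks are i.i.d. uniform *)

Lemma perm_rem (A : eqType) (a : A) (s t : seq A) :
  perm_eq s t -> perm_eq (rem a s) (rem a t).
Proof.
move=> st; have [ta|ta] := boolP (a \in t); last first.
  by rewrite !rem_id// (perm_mem st).
rewrite -(perm_cons a) -(permPr (perm_to_rem ta)).
by rewrite -(permPl (perm_to_rem _))// (perm_mem st).
Qed.

Section Freshness.
Context {R : realType} {N : nat}.
Local Notation U := (dunif R (enum 'I_N)).
Implicit Types M : machines N.

(** Equality of states as families of multi-sets: the order inside a block is forgotten, and the
    default of [nth] identifies missing blocks with empty ones. *)
Definition mach_equiv M M' : Prop :=
  active M = active M' /\
  forall j, perm_eq (nth [::] (blocks M) j) (nth [::] (blocks M') j).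

Definition mach_inv (H : machines N -> R) : Prop :=
  forall M M', mach_equiv M M' -> H M = H M'.

Definition remove_sample M (i : 'I_N) : machines N :=
  let k := active M in
  let b := rem i (nth [::] (blocks M) k) in
  Machines (if nilp b then k.+1 else k) (set_nth [::] (blocks M) k b).

Lemma expect_draw M (H : 'I_N * machines N -> R) :
  let b := nth [::] (blocks M) (active M) in
  expect (draw R M) H =
  (size b)%:R^-1 * \sum_(i <- b) H (i, remove_sample M i).
Proof.
rewrite /draw expect_dbind expect_dunif /=; congr (_ * _).
by apply: eq_bigr => i _; rewrite expect_dret.
Qed.

Lemma remove_sample_equiv M M' i :
  mach_equiv M M' -> mach_equiv (remove_sample M i) (remove_sample M' i).
Proof.
move=> [kE bE]; have remE := perm_rem i (bE (active M')).
split=> /= [|j]; first by rewrite /nilp kE (perm_size remE).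
by rewrite !nth_set_nth /= kE; case: eqP.
Qed.

Lemma expect_draw_inv (H : 'I_N -> machines N -> R) :
  (forall i, mach_inv (H i)) ->
  mach_inv (fun M => expect (draw R M) (fun iM => H iM.1 iM.2)).
Proof.
move=> invH M M' MM'; have [kE bE] := MM'.
have blockE := bE (active M'); rewrite !expect_draw /= kE.
rewrite (perm_size blockE) (perm_big _ blockE) /=.
congr (_ * _); apply: eq_bigr => i _; apply: invH.
exact: remove_sample_equiv.
Qed.

(* [fresh q p]: the next [q] draws from machines distributed as [p] are i.i.d.
   uniform. *)
Fixpoint fresh (q : nat) (p : dist R (machines N)) : Prop :=
  if q is q'.+1 then
    exists2 p', fresh q' p' &
      forall H : 'I_N -> machines N -> R, (forall i, mach_inv (H i)) ->
        expect p (fun M => expect (draw R M) (fun iM => H iM.1 iM.2)) =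
        expect U (fun i => expect p' (H i))
  else forall c, expect p (fun=> c) = c.

Definition layout (k : nat) (ls : seq nat) (r : seq 'I_N) : machines N :=
  Machines k (nseq k [::] ++ reshape ls r).

Lemma nth_nseq_cat (T : Type) k (ss : seq (seq T)) j :
  nth [::] (nseq k [::] ++ ss) j = if (j < k)%N then [::] else nth [::] ss (j - k).
Proof. by rewrite nth_cat size_nseq; case: ifP => // jk; rewrite nth_nseq jk. Qed.

(** Layouts are stable under a draw: the active length drops by one, and an exhausted block joins
    the empty prefix. *)
Lemma remove_sample_layout k l ls (s t : seq 'I_N) i :
    i \in s -> size s = l.+1 ->
  mach_equiv (remove_sample (layout k (l.+1 :: ls) (s ++ t)) i)
    (if l is 0 then layout k.+1 ls (rem i s ++ t)
     else layout k (l :: ls) (rem i s ++ t)).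
Proof.
move=> iS ss.
have sr : size (rem i s) = l by rewrite size_rem// ss.
have blocksE : blocks (layout k (l.+1 :: ls) (s ++ t)) =
    nseq k [::] ++ s :: reshape ls t.
  by rewrite /layout /= take_size_cat// drop_size_cat.
rewrite /remove_sample blocksE /= nth_cat size_nseq ltnn subnn /=.
case: l ss sr {blocksE} => [|l] ss sr.
  rewrite (size0nil sr) /=; split=> //= j.
  rewrite nth_set_nth /= -cat_cons.
  rewrite -[_ :: nseq k _]/(nseq k.+1 _) !nth_nseq_cat ltnS.
  by case: ltngtP => // kj; rewrite -(subnSK kj).
have -> : nilp (rem i s) = false by rewrite /nilp sr.
have reshapeE : reshape (l.+1 :: ls) (rem i s ++ t) = rem i s :: reshape ls t.
  by rewrite /reshape -/(reshape ls) take_size_cat// drop_size_cat.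
rewrite /layout reshapeE; split=> //= j; rewrite nth_set_nth /= !nth_nseq_cat.
by case: ltngtP => [jk|kj|->]; rewrite ?subnn //= -(subnSK kj).
Qed.

(** The lengths are nt, ..., nt and a possibly shorter last one. Only positive lengths are listed,
    so that the active block of a layout is never empty while samples remain. *)
Lemma sample_blocks_layout m nt q : (0 < nt)%N -> (q <= nt * m)%N ->
  exists ls, [/\ all (leq 1) ls, sumn ls = q & forall r : seq 'I_N, size r = q ->
    forall j, nth [::] (sample_blocks m nt r) j = nth [::] (reshape ls r) j].
Proof.
move=> nt_gt0; elim: m q => [|m IHm] q.
  rewrite muln0 leqn0 => /eqP ->; by exists [::].
have [-> _|q_gt0 qle] := posnP q.
  exists [::]; split=> // r /size0nil -> j; rewrite /= nth_nil.
  have [jm|jm] := ltnP j m.+1; last by rewrite nth_default// size_mkseq.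
  by rewrite nth_mkseq.
(* Truncated subtraction: the remainder is 0 if the sample ends within the first block. *)
have [] := IHm (q - nt)%N; first by rewrite leq_subLR -mulnS.
move=> ls [ls_gt0 lsE lsP].
exists (minn nt q :: ls); split=> [|/=|r rq j].
- by rewrite /= leq_min nt_gt0 q_gt0.
- by rewrite lsE minnE; case: (leqP nt q) => ?; lia.
have takeE : take (minn nt q) r = take nt r.
  by rewrite -rq; case: leqP => // ?; rewrite take_size take_oversize// ltnW.
have dropE : drop (minn nt q) r = drop nt r.
  by rewrite -rq; case: leqP => // ?; rewrite drop_size drop_oversize// ltnW.
case: j => [|j] /=; first by rewrite mul0n drop0 takeE.
rewrite dropE -lsP ?size_drop ?rq//.
have [jm|jm] := ltnP j m; last first.
  by rewrite !nth_default// ?size_mkseq ?size_map ?size_iota.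
rewrite nth_mkseq// (nth_map 0)// ?size_iota// nth_iota// drop_drop.
by rewrite add1n mulSn addnC.
Qed.

Hypothesis N_gt0 : (0 < N)%N.

Lemma expect_enum_cst (c : R) : expect U (fun=> c) = c.
Proof.
rewrite expect_dunif size_enum_ord big_enum /= sumr_const card_ord.
by rewrite -[c *+ N]mulr_natl mulrA mulVf ?mul1r// pnatr_eq0 -lt0n.
Qed.

Lemma layout_fresh k ls : all (leq 1) ls ->
  fresh (sumn ls)
    (sample r from diid U (sumn ls) ;; dret R (layout k ls r)).
Proof.
move: {2}(sumn ls) (erefl (sumn ls)) => q.
elim: q k ls => [|q IHq] k ls lsE ls_gt0.
  rewrite lsE => c; rewrite expect_dbind.
  under eq_expect do rewrite expect_dret.
  by apply: expect_diid_cst => ?; exact: expect_enum_cst.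
case: ls lsE ls_gt0 => [//|[//|l] ls] /= [lsE] ls_gt0.
(* The layout after one draw, following the two cases of [remove_sample_layout]. *)
pose k' := if l is 0 then k.+1 else k.
pose ls' := if l is 0 then ls else l :: ls.
have sum_ls' : sumn ls' = (l + sumn ls)%N by rewrite /ls'; case: (l).
exists (sample r from diid U (sumn ls') ;; dret R (layout k' ls' r)).
  rewrite sum_ls' lsE -lsE -sum_ls'.
  by apply: IHq; rewrite ?sum_ls'// /ls'; case: (l).
move=> H invH; rewrite expect_dbind.
under eq_expect do rewrite expect_dret.
rewrite -[sample a from U ;; _]/(diid U (l.+1 + sumn ls)) expect_diid_cat.
pose G i s := expect (diid U (sumn ls)) (fun t => H i (layout k' ls' (s ++ t))).
have sizeE s : size s = l.+1 ->
    expect (diid U (sumn ls)) (fun t => expect (draw R (layout k (l.+1 :: ls) (s ++ t)))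
      (fun iM => H iM.1 iM.2)) = l.+1%:R^-1 * \sum_(i <- s) G i (rem i s).
  move=> ss; have blockE t : nth [::] (blocks (layout k (l.+1 :: ls) (s ++ t))) k = s.
    by rewrite nth_nseq_cat ltnn subnn /reshape take_size_cat.
  under eq_expect => t do rewrite expect_draw [active _]/= blockE ss.
  rewrite expectZ expect_sum; congr (_ * _).
  rewrite big_seq [RHS]big_seq; apply: eq_bigr => i iS; apply: eq_expect => t.
  by rewrite (invH i _ _ (remove_sample_layout k ls t iS ss)) /k' /ls'; case: (l).
rewrite (eq_expect_diid _ sizeE) expectZ expect_diid_rem; last first.
  move=> i s t ss st; apply: eq_expect => r; apply: invH.
  rewrite /k' /ls'; case: l ss {lsE k' ls' sum_ls' G sizeE} => [|l] ss.
    by move: st; rewrite (size0nil ss) perm_sym => /perm_nilP ->; split.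
  have reshapeE u : size u = l.+1 ->
      reshape (l.+1 :: ls) (u ++ r) = u :: reshape ls r.
    by move=> su; rewrite /reshape -/(reshape ls) take_size_cat// drop_size_cat.
  rewrite /layout !reshapeE -?(perm_size st)//; split=> //= j.
  by rewrite !nth_nseq_cat; case: ifP => // _; case: (j - k)%N.
(* The factor [l.+1] produced by [expect_diid_rem] cancels the weight of a uniform draw from the
   block. *)
rewrite mulKf ?pnatr_eq0//; apply: eq_expect => i.
rewrite expect_dbind sum_ls' expect_diid_cat; apply: eq_expect => s.
by apply: eq_expect => t; rewrite expect_dret.
Qed.

End Freshness.

(** * Strong convexity from expansion of the gradient *)

Section StrongConvexity.
Context {R : realType} {d : nat}.
Implicit Types (f : 'rV[R]_d -> R) (x y : 'rV[R]_d) (m L mu : R).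

(** Compare the minorant at x with the majorant at y in the point y - s / (L - m), which minimizes
    majorant minus minorant. *)
Lemma lower_upper_cocoercive f m L x y s : m < L ->
    lower_bound_at_grad m f -> upper_bound_at_grad L f ->
    s = grad f y - grad f x - m *: (y - x) ->
  f x + dot (grad f x) (y - x) + m / 2 * dot (y - x) (y - x)
    + (2 * (L - m))^-1 * dot s s <= f y.
Proof.
move=> mL lo up sE; pose a := (L - m)^-1.
have := lo x (y - a *: s); have := up y (y - a *: s).
have -> : y - a *: s - y = - a *: s by rewrite addrAC subrr add0r scaleNr.
have -> : y - a *: s - x = (y - x) - a *: s by rewrite addrAC.
have : dot s s = dot (grad f y) s - dot (grad f x) s - m * dot (y - x) s.
  by rewrite {1}sE !dot_linE.
move: (y - x) s {sE} => r s ss; rewrite invfM -/a.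
have aL : a * (L - m) = 1 by rewrite mulVf// subr_eq0 gt_eqF.
clearbody a; rewrite !dot_linE (dotC s r) => h1 h2.
have h3 : a * dot (grad f y) s = a * (dot s s + dot (grad f x) s + m * dot r s).
  by rewrite ss; congr (_ * _); ring.
have h4 : a ^+ 2 * (L - m) * dot s s = a * dot s s.
  by rewrite expr2 -(mulrA a a) aL mulr1.
rewrite !expr2 in h4; nra.
Qed.

Lemma strongly_convex_lower f mu L : 0 <= mu ->
    (forall x y, norm2 (grad f x - grad f y) <= L * norm2 (x - y)) ->
    (forall x y, mu * norm2 (x - y) <= norm2 (grad f x - grad f y)) ->
    lower_bound_at_grad 0 f -> upper_bound_at_grad L f ->
  lower_bound_at_grad mu f.
Proof.
move=> mu_ge0 lip expand lo up.
have [Lmu|muL] := ltP L mu.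
  (* If [L < mu], expansion contradicts the Lipschitz bound unless the points coincide. *)
  move=> x y; suff -> : dot (y - x) (y - x) = 0.
    by have := lo x y; rewrite mul0r mul0r mulr0.
  rewrite -sqr_norm2; apply/eqP; rewrite sqrf_eq0.
  have := le_trans (expand y x) (lip y x); have := norm2_ge0 (y - x).
  rewrite le_eqVlt => /predU1P[<-//|n0].
  by rewrite ler_pM2r// leNgt Lmu.
pose E := [set m | [/\ 0 <= m, m <= mu & lower_bound_at_grad m f]]%classic.
have E0 : E 0 by [].
have E_ub : has_ubound E by exists mu => m [].
have improve m : E m -> m < mu -> E (m + (mu - m) ^+ 2 / (L - m)).
  move=> [m0 _ lom] m_mu; have mL : 0 < L - m by rewrite subr_gt0 (lt_le_trans m_mu).
  split=> [||x y].
  - by rewrite addr_ge0// divr_ge0 ?sqr_ge0 ?ltW.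
  - rewrite -lerBrDl ler_pdivrMr// expr2 ler_wpM2l ?lerB//.
    by rewrite subr_ge0 ltW.
  have m_L : m < L by rewrite -subr_gt0.
  have := lower_upper_cocoercive m_L lom up
    (erefl (grad f y - grad f x - m *: (y - x))).
  apply: le_trans; rewrite mulrDl mulrDl addrA lerD2l.
  have -> : (mu - m) ^+ 2 / (L - m) / 2 * dot (y - x) (y - x) =
      (2 * (L - m))^-1 * ((mu - m) ^+ 2 * dot (y - x) (y - x)).
    by field; rewrite gt_eqF.
  apply: ler_wpM2l; first by rewrite invr_ge0 mulr_ge0// ltW.
  have := expand y x; have := dot_le_norm2 (y - x) (grad f y - grad f x).
  have := norm2_ge0 (y - x).
  move: (y - x) (grad f y - grad f x) => r g.
  rewrite !dot_linE -!sqr_norm2 (dotC g r).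
  move: (norm2 r) (norm2 g) (dot r g) => p q w p0 wpq pq.
  (* With p = |r| and q = |g|, the claim is |g - m r| >= q - m p >= (mu - m) p; [h1] and [h2] handle
     the cross term and the square after writing q - m p = (q - mu p) + (mu - m) p. *)
  have h1 : 0 <= (mu - m) * p * (q - mu * p).
    by rewrite !mulr_ge0// subr_ge0// ltW.
  have h2 := sqr_ge0 (q - mu * p).
  have h3 : m * w <= m * (p * q) by rewrite ler_wpM2l.
  by lra.
have sup_ge0 : 0 <= sup E by exact: (ub_le_sup E_ub).
have sup_le : sup E <= mu by apply: ge_sup => [|m []]; first by exists 0.
(* For fixed x and y the condition is affine in m, hence passes to the supremum. *)
have EsupE : E (sup E).
  split=> // x y; have := dot_ge0 (y - x).
  rewrite le_eqVlt => /predU1P[r0|r_gt0].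
    by have := lo x y; rewrite -r0 !mulr0.
  rewrite -lerBrDl mulrAC ler_pdivrMr// -ler_pdivlMr//.
  apply: ge_sup => [|m [_ _ /(_ x y)]]; first by exists 0.
  by rewrite ler_pdivlMr// -ler_pdivrMr// mulrAC -lerBrDl.
have [->//|sup_neq] := eqVneq mu (sup E); first by case: EsupE.
have sup_lt : sup E < mu by rewrite lt_neqAle eq_sym sup_neq.
(* A supremum below [mu] would be improved by a strictly positive amount inside [E]. *)
have /(ub_le_sup E_ub) := improve _ EsupE sup_lt.
rewrite gerDl leNgt divr_gt0//; first by rewrite exprn_gt0// subr_gt0.
by rewrite subr_gt0 (lt_le_trans sup_lt).
Qed.

End StrongConvexity.

(** * The average of the f_i and its gradient as uniform expectations *)

Section Average.
Context {R : realType} {d N : nat} (f : 'I_N -> 'rV[R]_d -> R).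
Local Notation U := (dunif R (enum 'I_N)).
Hypothesis f_diff : forall i x, differentiable (f i) x.

Lemma expect_enumE (F : 'I_N -> R) : expect U F = N%:R^-1 * \sum_(i < N) F i.
Proof. by rewrite expect_dunif size_enum_ord big_enum. Qed.

Lemma favg_expect x : favg f x = expect U (fun i => f i x).
Proof. by rewrite expect_enumE. Qed.

Lemma grad_favg x : grad (favg f) x = N%:R^-1 *: \sum_(i < N) grad (f i) x.
Proof.
apply/rowP => k; rewrite !mxE summxE.
have -> : favg f = N%:R^-1 \*: \sum_(i < N) f i.
  by apply/funext => y; rewrite /favg /= fct_sumE.
rewrite deriveZ; last first.
  by apply: derivable_sum => i; exact: diff_derivable.
rewrite derive_sum; last by move=> i; exact: diff_derivable.
by congr (_ * _); apply: eq_bigr => i _; rewrite mxE.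
Qed.

Lemma dot_grad_favg x v :
  dot (grad (favg f) x) v = expect U (fun i => dot (grad (f i) x) v).
Proof.
rewrite grad_favg dotZl dotC dot_sumr expect_enumE; congr (_ * _).
by apply: eq_bigr => i _; rewrite dotC.
Qed.

End Average.

(** * One SVRG stage with i.i.d. uniform indices *)

Section SvrgAnalysis.
Context {R : realType} {d N : nat}.
Context (f : 'I_N -> 'rV[R]_d -> R) (L mu eta : R) (xs : 'rV[R]_d).
Local Notation U := (dunif R (enum 'I_N)).
Local Notation F := (favg f).
Hypothesis N_gt0 : (0 < N)%N.
Hypothesis f_diff : forall i x, differentiable (f i) x.
Hypothesis f_lower : forall i, lower_bound_at_grad 0 (f i).
Hypothesis f_upper : forall i, upper_bound_at_grad L (f i).
Hypothesis xs_min : forall x, F xs <= F x.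

Lemma ler_expect_enum (G H : 'I_N -> R) : (forall i, G i <= H i) ->
  expect U G <= expect U H.
Proof.
move=> GH; rewrite !expect_enumE; apply: ler_wpM2l; first by rewrite invr_ge0.
by apply: ler_sum.
Qed.

Lemma favg_lower : lower_bound_at_grad 0 F.
Proof.
move=> x y; rewrite mul0r mul0r addr0 dot_grad_favg// !favg_expect -expectD.
by apply: ler_expect_enum => i; have := f_lower i x y; rewrite mul0r mul0r addr0.
Qed.

Lemma favg_upper : upper_bound_at_grad L F.
Proof.
move=> x y; rewrite dot_grad_favg// !favg_expect.
rewrite -[_ / _ * _](expect_enum_cst N_gt0) -!expectD.
by apply: ler_expect_enum => i; exact: f_upper.
Qed.

Hypothesis L_gt0 : 0 < L.

(** A gradient step of length 1/L from [xs] would lower F by at least |g|^2 / (2 L). *)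
Lemma grad_favg_min : grad F xs = 0.
Proof.
set g := grad F xs; apply: dot_eq0; apply/eqP; rewrite eq_le dot_ge0 andbT.
have := le_trans (xs_min _) (favg_upper xs (xs - L^-1 *: g)).
rewrite -/g [_ - _ - _]addrAC subrr add0r !dot_linE.
have Linv : L * L^-1 * L^-1 * dot g g = L^-1 * dot g g by rewrite mulfV ?gt_eqF// mul1r.
move=> h; rewrite -(pmulr_rle0 _ (_ : 0 < L^-1)) ?invr_gt0//; lra.
Qed.

Definition gap x := F x - F xs.

Lemma gap_ge0 x : 0 <= gap x.
Proof. by rewrite subr_ge0. Qed.

Lemma gap_le_sqr x : gap x <= L / 2 * dot (x - xs) (x - xs).
Proof.
have := favg_upper xs x; rewrite grad_favg_min -[0](scale0r 0) dotZl mul0r addr0.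
by rewrite /gap => h; lra.
Qed.

(** Average the cocoercivity of each f_i between [xs] and x; the linear term vanishes because the
    gradient of F at [xs] is 0. *)
Lemma grad_dist_le_gap x :
  expect U (fun i => dot (grad (f i) x - grad (f i) xs)
                         (grad (f i) x - grad (f i) xs)) <= 2 * L * gap x.
Proof.
have coco i : dot (grad (f i) x - grad (f i) xs) (grad (f i) x - grad (f i) xs)
    <= 2 * L * (f i x - f i xs - dot (grad (f i) xs) (x - xs)).
  have /= := lower_upper_cocoercive (x := xs) (y := x) L_gt0 (f_lower i)
    (f_upper i) erefl.
  rewrite scale0r !subr0 mul0r mul0r addr0.
  rewrite -lerBrDl ler_pdivrMl ?mulr_gt0// opprD addrA.
  done.
apply: le_trans (ler_expect_enum coco) _.
rewrite expectZ; under eq_expect do rewrite -addrA -opprD -scaleN1r [_ *: _]/(_ * _).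
rewrite expectD expectZ expectD -!favg_expect -(dot_grad_favg f_diff) grad_favg_min.
by rewrite -[0 : 'rV_d](scale0r 0) dotZl mul0r addr0 mulN1r.
Qed.

Definition svrg_dir xt x i :=
  grad (f i) x - grad (f i) xt + grad F xt.

Lemma expect_svrg_dir xt x v :
  expect U (fun i => dot (svrg_dir xt x i) v) = dot (grad F x) v.
Proof.
under eq_expect do rewrite /svrg_dir dotDl dotDl dotNl -mulN1r.
rewrite !expectD expectZ expect_enum_cst// -!(dot_grad_favg f_diff).
by rewrite mulN1r subrK.
Qed.

(* With [a i = grad f_i x - grad f_i xs] and [b i = grad f_i xt - grad f_i xs],
   the direction is [a i - (b i - E b)]; a variance is at most the second
   moment. *)
Lemma expect_sqr_svrg_dir xt x :
  expect U (fun i => dot (svrg_dir xt x i) (svrg_dir xt x i)) <=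
  4 * L * (gap x + gap xt).
Proof.
pose a y i := grad (f i) y - grad (f i) xs; set h := grad F xt.
(* From |u - z|^2 <= 2 |u|^2 + 2 |z|^2 with z = [a xt i - h]; the terms involving h average to -2
   |h|^2. *)
have split_sqr i : dot (svrg_dir xt x i) (svrg_dir xt x i) <=
    2 * dot (a x i) (a x i)
    + (2 * dot (a xt i) (a xt i) + (- 4 * dot (a xt i) h + 2 * dot h h)).
  have -> : svrg_dir xt x i = a x i - (a xt i - h).
    by rewrite /svrg_dir -/h; apply/rowP => k; rewrite !mxE; ring.
  have := dot_ge0 (a x i + (a xt i - h)).
  move: (a x i) (a xt i) => u w; rewrite !dot_linE.
  by rewrite (dotC w u) (dotC h u) (dotC h w); lra.
apply: le_trans (ler_expect_enum split_sqr) _.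
rewrite !expectD !expectZ expect_enum_cst//.
have -> : expect U (fun i => dot (a xt i) h) = dot h h.
  under eq_expect do rewrite /a dotDl dotNl -mulN1r.
  rewrite expectD expectZ -!(dot_grad_favg f_diff) grad_favg_min -/h.
  by rewrite -[0 : 'rV_d](scale0r 0) dotZl mul0r mulr0 addr0.
have := grad_dist_le_gap x; have := grad_dist_le_gap xt; have := dot_ge0 h.
by rewrite -/(a x) -/(a xt) /a; lra.
Qed.

(** Expand the square: the cross term is handled by unbiasedness and convexity, the quadratic one by
    the variance bound. *)
Lemma expect_dist_step xt x : 0 < eta ->
  expect U (fun i => dot (x - eta *: svrg_dir xt x i - xs)
                         (x - eta *: svrg_dir xt x i - xs)) <=
  dot (x - xs) (x - xs) - 2 * eta * (1 - 2 * L * eta) * gap x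
  + 4 * L * eta ^+ 2 * gap xt.
Proof.
move=> eta_gt0; have dist_expand i :
    dot (x - eta *: svrg_dir xt x i - xs) (x - eta *: svrg_dir xt x i - xs) =
    dot (x - xs) (x - xs) + (- (2 * eta) * dot (svrg_dir xt x i) (x - xs)
    + eta ^+ 2 * dot (svrg_dir xt x i) (svrg_dir xt x i)).
  rewrite [x - _ - _]addrAC; move: (svrg_dir xt x i) (x - xs) => v r.
  by rewrite !dot_linE (dotC r v); ring.
rewrite (eq_expect _ dist_expand) !expectD !expectZ expect_enum_cst//.
rewrite expect_svrg_dir.
have h1 : eta ^+ 2 * expect U (fun i => dot (svrg_dir xt x i) (svrg_dir xt x i))
    <= eta ^+ 2 * (4 * L * (gap x + gap xt)).
  by apply: ler_wpM2l; [exact: sqr_ge0 | exact: expect_sqr_svrg_dir].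
have h2 : eta * gap x <= eta * dot (grad F x) (x - xs).
  apply: ler_wpM2l; first exact: ltW.
  have := favg_lower x xs; rewrite mul0r mul0r addr0 -[xs - x]opprB dotNr /gap.
  by lra.
by lra.
Qed.

Definition svrg_average t (x' xbar : 'rV[R]_d) : 'rV[R]_d :=
  t.+1%:R^-1 *: (x' + t%:R *: xbar).

(** Jensen's inequality: add the tangent bounds at the average with weights 1 and t; their linear
    terms cancel. *)
Lemma gap_average t x' xbar :
  t.+1%:R * gap (svrg_average t x' xbar) <= gap x' + t%:R * gap xbar.
Proof.
set z := svrg_average t x' xbar.
have zE : t.+1%:R *: z = x' + t%:R *: xbar.
  by rewrite scalerA mulfV ?pnatr_eq0// scale1r.
have h1 := favg_lower z x'; have h2 := favg_lower z xbar.
have : dot (grad F z) (x' - z) + t%:R * dot (grad F z) (xbar - z) = 0.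
  rewrite -dotZr -dotDr scalerBr addrACA -zE -opprD.
  have -> : z + t%:R *: z = t.+1%:R *: z by rewrite -natr1 scalerDl scale1r addrC.
  by rewrite subrr -[0 : 'rV_d](scale0r 0) dotZr mul0r.
have h3 : t%:R * (F z + dot (grad F z) (xbar - z)) <= t%:R * F xbar.
  by apply: ler_wpM2l => //; move: h2; rewrite mul0r mul0r addr0.
by move: h1; rewrite mul0r mul0r addr0 /gap -natr1; lra.
Qed.

(* The one-step recursion controls the gaps of x_0, ..., x_(T-1) whereas the
   average is over x_1, ..., x_T; the last term makes up for this shift. *)
Definition potential t (s : 'rV[R]_d * 'rV[R]_d) : R :=
  2 * eta * (1 - 2 * L * eta) * (t%:R * gap s.2)
  + dot (s.1 - xs) (s.1 - xs) - 2 * eta * (1 - 2 * L * eta) * gap s.1.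

(** The idealized iteration, with a new uniform index in place of the machine state. *)
Definition iid_iter xt t (s : 'rV[R]_d * 'rV[R]_d) :
    dist R ('rV[R]_d * 'rV[R]_d) :=
  sample i from U ;;
  let x' := s.1 - eta *: svrg_dir xt s.1 i in
  dret R (x', svrg_average t x' s.2).

Lemma expect_iid_iter xt t s H :
  expect (iid_iter xt t s) H = expect U (fun i =>
    let x' := s.1 - eta *: svrg_dir xt s.1 i in
    H (x', svrg_average t x' s.2)).
Proof.
by rewrite expect_dbind; apply: eq_expect => i; rewrite expect_dret.
Qed.

Lemma ler_expect_iid_loop xt l s G H : (forall s, G s <= H s) ->
  expect (dfor (iid_iter xt) l s) G <= expect (dfor (iid_iter xt) l s) H.
Proof.
move=> GH; elim: l s => [|t l IHl] s; first by rewrite !expect_dret.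
by rewrite !expect_dfor_cons !expect_iid_iter; apply: ler_expect_enum => i.
Qed.

Hypothesis eta_gt0 : 0 < eta.
Hypothesis eta_lt : eta < (4 * L)^-1.

Lemma Leta_lt : 4 * L * eta < 1.
Proof. by rewrite -ltr_pdivlMl ?mulr_gt0// mulr1. Qed.

Lemma coef_gt0 : 0 < 2 * eta * (1 - 2 * L * eta).
Proof.
rewrite !mulr_gt0// subr_gt0.
by have := mulr_gt0 L_gt0 eta_gt0; have := Leta_lt; lra.
Qed.

(** The gap of the new iterate coming from the average cancels the last term of the new potential;
    the distance step then supplies the last term of the old one. *)
Lemma expect_potential_step xt t s :
  expect (iid_iter xt t s) (potential t.+1) <=
  potential t s + 4 * L * eta ^+ 2 * gap xt.
Proof.
rewrite expect_iid_iter.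
have step_le i : potential t.+1 (s.1 - eta *: svrg_dir xt s.1 i,
      svrg_average t (s.1 - eta *: svrg_dir xt s.1 i) s.2) <=
    2 * eta * (1 - 2 * L * eta) * (t%:R * gap s.2)
    + dot (s.1 - eta *: svrg_dir xt s.1 i - xs)
          (s.1 - eta *: svrg_dir xt s.1 i - xs).
  rewrite /potential /=; set x' := s.1 - _.
  have := ler_wpM2l (ltW coef_gt0) (gap_average t x' s.2).
  by rewrite mulrDr; lra.
apply: le_trans (ler_expect_enum step_le) _.
rewrite expectD expect_enum_cst// /potential.
by have := expect_dist_step xt s.1 eta_gt0; lra.
Qed.

Lemma expect_potential_loop xt t k s :
  expect (dfor (iid_iter xt) (iota t k) s) (potential (t + k)) <=
  potential t s + k%:R * (4 * L * eta ^+ 2 * gap xt).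
Proof.
elim: k t s => [|k IHk] t s; first by rewrite addn0 expect_dret mul0r addr0.
rewrite /= -/(iota t.+1 k) expect_dfor_cons expect_iid_iter.
apply: le_trans (ler_expect_enum _) _.
  by move=> i; rewrite addnS -addSn; exact: IHk.
rewrite expectD expect_enum_cst//.
have := expect_potential_step xt t s; rewrite expect_iid_iter => step.
by apply: le_trans (lerD step (lexx _)) _; rewrite -natr1; lra.
Qed.

Hypothesis mu_gt0 : 0 < mu.
Hypothesis F_lower : lower_bound_at_grad mu F.

Definition rate T : R :=
  1 / (mu * eta * (1 - 4 * L * eta) * T%:R)
  + 4 * L * eta * (T%:R + 1) / ((1 - 4 * L * eta) * T%:R).

Lemma rate_ge0 T : 0 <= rate T.
Proof.
have ? : 0 <= 1 - 4 * L * eta by rewrite subr_ge0 ltW// Leta_lt.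
have [[mu0 L0] eta0] := (ltW mu_gt0, ltW L_gt0, ltW eta_gt0).
by rewrite /rate addr_ge0// divr_ge0// !mulr_ge0// addr_ge0.
Qed.

Lemma expect_iid_stage xt T : (0 < T)%N ->
  expect (dfor (iid_iter xt) (iota 0 T) (xt, 0)) (fun s => gap s.2) <=
  rate T * gap xt.
Proof.
move=> T_gt0; have T0 : 0 < T%:R :> R by rewrite ltr0n.
set c := 2 * eta * (1 - 2 * L * eta).
have lower_potential s : c * T%:R * gap s.2 <= potential T s.
  rewrite /potential -/c.
  have h1 := ler_wpM2l (ltW coef_gt0) (gap_le_sqr s.1).
  (* Smoothness lets the squared distance of the last iterate absorb its negative gap term. *)
  have h2 : c * (L / 2) <= 1.
    have -> : c * (L / 2) = L * eta * (1 - 2 * (L * eta)) by rewrite /c; field.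
    have := mulr_gt0 L_gt0 eta_gt0; have := Leta_lt; rewrite -mulrA.
    by move: (L * eta) => u; nra.
  have := ler_wpM2r (dot_ge0 (s.1 - xs)) h2.
  by rewrite -/c in h1; lra.
have strong : mu / 2 * dot (xt - xs) (xt - xs) <= gap xt.
  have := F_lower xs xt; rewrite grad_favg_min -[0 : 'rV_d](scale0r 0) dotZl.
  by rewrite mul0r /gap; lra.
have := ler_expect_iid_loop xt (iota 0 T) (xt, 0) lower_potential.
rewrite expectZ => h1.
have := le_trans h1 (expect_potential_loop xt 0 T (xt, 0)).
rewrite /potential /= mul0r mulr0 add0r -/c.
set V := expect _ _ => h2.
have g0 := gap_ge0 xt.
have c_gt0 : 0 < c := coef_gt0.
have cg : 0 <= c * gap xt by rewrite mulr_ge0// ltW.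
(* Quadratic growth bounds the initial distance by the initial gap; the negative gap term of the
   initial potential is dropped. *)
have h3 : c * T%:R * V <= (2 / mu + T%:R * (4 * L * eta ^+ 2)) * gap xt.
  have : dot (xt - xs) (xt - xs) <= 2 / mu * gap xt.
    by rewrite mulrAC ler_pdivlMr//; lra.
  by lra.
have cT : 0 < c * T%:R by rewrite mulr_gt0.
rewrite -(ler_pM2l cT); apply: le_trans h3 _.
rewrite [leRHS]mulrA; apply: ler_wpM2r => //.
have b_gt0 : 0 < 1 - 4 * L * eta by rewrite subr_gt0 Leta_lt.
(* The surplus of the stated rate over the derived bound is an explicit sum of nonnegative terms. *)
have -> : c * T%:R * rate T = (2 / mu + T%:R * (4 * L * eta ^+ 2))
   + (4 * L * eta / (1 - 4 * L * eta) / mu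
   + 4 * L * eta ^+ 2 * (T%:R + 1 + (1 - 4 * L * eta)) / (1 - 4 * L * eta)).
  rewrite /rate /c; field.
  by rewrite !gt_eqF.
have [[[mu0 L0] eta0] b0] := (ltW mu_gt0, ltW L_gt0, ltW eta_gt0, ltW b_gt0).
rewrite lerDl; move: (1 - 4 * L * eta) b0 => b b0.
by rewrite addr_ge0 ?divr_ge0 ?mulr_ge0 ?addr_ge0.
Qed.

End SvrgAnalysis.

(** * Transfer from i.i.d. iterations to the distributed algorithm *)

Section Dsvrg.
Context {R : realType} {d m n N : nat} (f : 'I_N -> 'rV[R]_d -> R) (eta : R).
Local Notation F := (favg f).
Local Notation iter xt := (svrg_iter f eta xt (grad F xt)).

(** Injectivity turns the sum over machines into a sum over the parts, which cover each index
    exactly once. *)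
Lemma full_gradient_grad (part : {ffun 'I_m -> {set 'I_N}}) x :
  (forall i x, differentiable (f i) x) -> is_allocation n part ->
  full_gradient f part x = grad F x.
Proof.
move=> f_diff /and3P[part_partition /injectiveP part_inj _].
rewrite /full_gradient grad_favg//; congr (_ *: _).
rewrite -(big_imset (fun A : {set 'I_N} => \sum_(i in A) grad (f i) x))/=; last first.
  by move=> i j _ _ /part_inj.
rewrite -(finset.set_partition_big _ part_partition) /=.
by apply: eq_bigl => i; rewrite inE.
Qed.

Lemma expect_svrg_iter xt t x xbar M H :
  expect (iter xt t (x, xbar, M)) H =
  expect (draw R M) (fun iM =>
    let x' := x - eta *: svrg_dir f xt x iM.1 in
    H (x', svrg_average t x' xbar, iM.2)).
Proof.
by rewrite /svrg_iter expect_dbind; apply: eq_expect => -[i M']; rewrite expect_dret.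
Qed.

Lemma svrg_loop_inv xt H : (forall x xbar, mach_inv (fun M => H (x, xbar, M))) ->
  forall l x xbar,
    mach_inv (fun M => expect (dfor (iter xt) l (x, xbar, M)) H).
Proof.
move=> invH; elim=> [|t l IHl] x xbar M M' MM'.
  by rewrite !expect_dret; exact: invH.
rewrite !expect_dfor_cons !expect_svrg_iter.
apply: (expect_draw_inv (H := fun i M => expect (dfor (iter xt) l
  (x - eta *: svrg_dir f xt x i,
   svrg_average t (x - eta *: svrg_dir f xt x i) xbar, M)) H)) MM' => i.
exact: IHl.
Qed.

(** The law [p'] of the machines after T draws is chosen before the reference point, the iterates
    and the test function: this expresses its independence from the past of the algorithm. *)
Lemma fresh_svrg_loop T q p : fresh (T + q) p ->
  exists2 p', fresh q p' & forall xt l x xbar H, size l = T ->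
    (forall x xbar, mach_inv (fun M => H (x, xbar, M))) ->
    expect p (fun M => expect (dfor (iter xt) l (x, xbar, M)) H) =
    expect (dfor (iid_iter f eta xt) l (x, xbar))
      (fun s => expect p' (fun M => H (s, M))).
Proof.
elim: T p => [|T IHT] p.
  move=> p_fresh; exists p => // xt l x xbar H /size0nil -> _.
  by rewrite expect_dret; apply: eq_expect => M; rewrite expect_dret.
move=> [p1 /IHT[p' p'_fresh p'P] p1P]; exists p' => // xt [//|t l] x xbar H [lT] invH.
rewrite expect_dfor_cons expect_iid_iter.
under eq_expect do rewrite expect_dfor_cons expect_svrg_iter.
rewrite (p1P (fun i M => expect (dfor (iter xt) l
  (x - eta *: svrg_dir f xt x i,
   svrg_average t (x - eta *: svrg_dir f xt x i) xbar, M)) H)); last first.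
  by move=> i; exact: svrg_loop_inv.
by apply: eq_expect => i; rewrite p'P.
Qed.

Context (part : {ffun 'I_m -> {set 'I_N}}) (T : nat).
Hypothesis part_grad : forall x, full_gradient f part x = grad F x.
Local Notation stage := (dsvrg_stage f eta T part).

Lemma expect_dsvrg_stage l xt M H :
  expect (stage l (xt, M)) H =
  expect (dfor (iter xt) (iota 0 T) (xt, 0, M)) (fun s => H (s.1.2, s.2)).
Proof.
rewrite /dsvrg_stage /ss_svrg part_grad expect_dbind.
by apply: eq_expect => -[[x xbar] M']; rewrite expect_dret.
Qed.

Lemma dsvrg_loop_inv H : (forall x, mach_inv (fun M => H (x, M))) ->
  forall l xt, mach_inv (fun M => expect (dfor stage l (xt, M)) H).
Proof.
move=> invH; elim=> [|t l IHl] xt M M' MM'.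
  by rewrite !expect_dret; exact: invH.
rewrite !expect_dfor_cons !expect_dsvrg_stage.
by apply: svrg_loop_inv MM' => x xbar; exact: IHl.
Qed.

Context (L mu : R) (xs : 'rV[R]_d).
Hypothesis N_gt0 : (0 < N)%N.
Hypothesis f_diff : forall i x, differentiable (f i) x.
Hypothesis f_lower : forall i, lower_bound_at_grad 0 (f i).
Hypothesis f_upper : forall i, upper_bound_at_grad L (f i).
Hypothesis xs_min : forall x, F xs <= F x.
Hypothesis L_gt0 : 0 < L.
Hypothesis eta_gt0 : 0 < eta.
Hypothesis eta_lt : eta < (4 * L)^-1.
Hypothesis mu_gt0 : 0 < mu.
Hypothesis F_lower : lower_bound_at_grad mu F.
Hypothesis T_gt0 : (0 < T)%N.

Lemma expect_dsvrg_loop l p xt : fresh (T * size l) p ->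
  expect p (fun M => expect (dfor stage l (xt, M)) (fun s => gap f xs s.1)) <=
  rate L mu eta T ^+ size l * gap f xs xt.
Proof.
elim: l p xt => [|k l IHl] p xt.
  rewrite muln0 mul1r => p1.
  by under eq_expect do rewrite expect_dret /=; rewrite p1.
rewrite [size _]/= mulnS => /fresh_svrg_loop[p' p'_fresh p'P].
under eq_expect do rewrite expect_dfor_cons expect_dsvrg_stage.
rewrite (p'P xt _ _ _ (fun s => expect (dfor stage l (s.1.2, s.2))
    (fun s => gap f xs s.1)));
  last 2 first.
- exact: size_iota.
- by move=> x xbar; exact: dsvrg_loop_inv.
(* Since [p'] does not depend on the outcome [s] of the stage, the induction hypothesis applies at
   each new reference point [s.2]. *)
apply: le_trans (ler_expect_iid_loop _ _ _ _ _ (fun s => IHl p' s.2 p'_fresh)) _.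
rewrite expectZ exprSr -mulrA ler_wpM2l//.
  by apply: exprn_ge0; exact: (rate_ge0 L_gt0 eta_gt0 eta_lt mu_gt0).
exact: expect_iid_stage.
Qed.

End Dsvrg.

(** * Lipschitz gradient of the average, and the final bounds *)

(** Pair the gradient difference g with itself and average: |g|^2 is the mean of the products of the
    individual differences with g, each at most L |x - y| |g|. *)
Lemma norm2_grad_favg_le (R : realType) (d N : nat)
    (f : 'I_N -> 'rV[R]_d -> R) (L : R) :
    (0 < N)%N -> (forall i, smooth L (f i)) -> forall x y,
  norm2 (grad (favg f) x - grad (favg f) y) <= L * norm2 (x - y).
Proof.
move=> N_gt0 f_smooth x y; set g := _ - _.
have f_diff i z : differentiable (f i) z by case: (f_smooth i).
have lip i : norm2 (grad (f i) x - grad (f i) y) <= L * norm2 (x - y).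
  by case: (f_smooth i).
have Lr_ge0 := le_trans (norm2_ge0 _) (lip (Ordinal N_gt0)).
have := norm2_ge0 g; rewrite le_eqVlt => /predU1P[<-//|g_gt0].
rewrite -(ler_pM2l g_gt0) -expr2 sqr_norm2 {1}/g dotDl dotNl.
rewrite !dot_grad_favg// -mulN1r -expectZ -expectD.
rewrite -[leRHS](expect_enum_cst N_gt0); apply: ler_expect_enum => i.
rewrite mulN1r -dotNl -dotDl mulrC; apply: le_trans (dot_le_norm2 _ _) _.
by apply: ler_wpM2r (lip i); exact: ltW.
Qed.

(** Fix the partition, replace the sample blocks by an equivalent layout, and apply the stage
    recursion to this fresh state. *)
Lemma expect_dsvrg (R : realType) (d m n N nt : nat)
    (f : 'I_N -> 'rV[R]_d -> R) (L mu eta : R) (xs x0 : 'rV[R]_d) (T K : nat) :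
    (0 < N)%N -> (forall i x, differentiable (f i) x) ->
    (forall i, lower_bound_at_grad 0 (f i)) ->
    (forall i, upper_bound_at_grad L (f i)) ->
    (forall x, favg f xs <= favg f x) -> 0 < L -> 0 < eta -> eta < (4 * L)^-1 ->
    0 < mu -> lower_bound_at_grad mu (favg f) -> (0 < T)%N ->
    (0 < nt)%N -> (T * K <= nt * m)%N ->
  expect (dsvrg m n nt f eta T K x0) (gap f xs) <=
  rate L mu eta T ^+ K * gap f xs x0.
Proof.
move=> N_gt0 f_diff f_lower f_upper xs_min L_gt0 eta_gt0 eta_lt mu_gt0 F_lower.
move=> T_gt0 nt_gt0 TK; rewrite expect_dbind; apply: expect_dunif_le.
  rewrite mulr_ge0 ?gap_ge0// exprn_ge0//.
  exact: (rate_ge0 L_gt0 eta_gt0 eta_lt mu_gt0).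
move=> part; rewrite mem_filter => /andP[part_alloc _].
have part_grad x := full_gradient_grad x f_diff part_alloc.
rewrite expect_dbind.
have [ls [ls_gt0 lsE lsP]] := sample_blocks_layout (N := N) nt_gt0 TK.
have outE r : size r = (T * K)%N ->
    expect (sample (xt, _) from dfor (dsvrg_stage f eta T part) (iota 0 K)
      (x0, Machines 0 (sample_blocks m nt r)) ;; dret R xt) (gap f xs) =
    expect (dfor (dsvrg_stage f eta T part) (iota 0 K) (x0, layout 0 ls r))
      (fun s => gap f xs s.1).
  move=> rE; rewrite expect_dbind.
  transitivity (expect (dfor (dsvrg_stage f eta T part) (iota 0 K)
      (x0, Machines 0 (sample_blocks m nt r))) (fun s => gap f xs s.1)).
    by apply: eq_expect => -[xt M]; rewrite expect_dret.
  apply: dsvrg_loop_inv => //; split=> //= j.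
  by rewrite lsP.
rewrite (eq_expect_diid _ outE).
have := layout_fresh (R := R) N_gt0 0 ls_gt0; rewrite lsE => p_fresh.
have := expect_dsvrg_loop part_grad N_gt0 f_diff f_lower f_upper xs_min L_gt0
  eta_gt0 eta_lt mu_gt0 F_lower T_gt0 (l := iota 0 K) x0.
rewrite size_iota => /(_ _ p_fresh); rewrite expect_dbind.
by under eq_expect do rewrite expect_dret.
Qed.

Theorem theorem1 (R : realType) (d m n N C : nat) (c : R)
  (f : 'I_N -> 'rV[R]_d -> R) (L mu : R) (xs x0 : 'rV[R]_d)
  (hm : (0 < m)%N) (hn : (0 < n)%N) (hN : N = (m * n)%N)
  (hC : (n < C < N)%N) (hc : 0 < c) (hcn : c * n%:R <= (C - n)%:R)
  (hconvex : forall i, convex_fun (f i))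
  (hsmooth : forall i, smooth L (f i))
  (hstrong : strongly_convex mu (favg f))
  (hmin : forall x, favg f xs <= favg f x) :
  (forall (eta : R) (T K Q : nat),
      0 < eta -> eta < (4 * L)^-1 -> (0 < T)%N -> (0 < K)%N ->
      (T * K)%N = Q -> (Q <= (C - n) * m)%N ->
      expect (dsvrg m n (C - n) f eta T K x0) (fun x => favg f x - favg f xs)
      <= (1 / (mu * eta * (1 - 4 * L * eta) * T%:R)
          + 4 * L * eta * (T%:R + 1) / ((1 - 4 * L * eta) * T%:R)) ^+ K
         * (favg f x0 - favg f xs))
  /\
  (forall (eps : R) (T K Q : nat),
      0 < eps ->
      T%:Z = Num.ceil (96 * (L / mu)) ->
      K%:Z = Num.max 1
        (Num.ceil (1 / ln (9 / 8) * ln ((favg f x0 - favg f xs) / eps))) ->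
      (T * K)%N = Q -> (Q <= (C - n) * m)%N ->
      eps_optimal (favg f) xs eps
        (dsvrg m n (C - n) f (1 / (16 * L)) T K x0)).
Proof.
have nt_gt0 : (0 < C - n)%N by rewrite subn_gt0; case/andP: hC.
have N_gt0 : (0 < N)%N by rewrite hN muln_gt0 hm.
have f_diff i x : differentiable (f i) x by case: (hsmooth i).
have f_lower i : lower_bound_at_grad 0 (f i) by exact: convex_lower.
have f_upper i : upper_bound_at_grad L (f i) by exact: smooth_upper.
have [mu_gt0 _ expand] := hstrong.
have lip := norm2_grad_favg_le N_gt0 hsmooth.
have F_lower : lower_bound_at_grad mu (favg f).
  apply: (strongly_convex_lower (L := L)) => //; first exact: ltW.
    exact: favg_lower.
  exact: favg_upper.
have bound eta T K : 0 < eta -> eta < (4 * L)^-1 -> (0 < T)%N ->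
    (T * K <= (C - n) * m)%N ->
    expect (dsvrg m n (C - n) f eta T K x0) (gap f xs) <=
    rate L mu eta T ^+ K * gap f xs x0.
  move=> eta_gt0 eta_lt T_gt0 TK; apply: expect_dsvrg => //.
  (* Positivity of L is read off from 0 < eta < 1 / (4 L). *)
  by have := lt_trans eta_gt0 eta_lt; rewrite invr_gt0 pmulr_rgt0.
split=> [eta T K Q eta_gt0 eta_lt T_gt0 _ <- TK|eps T K Q eps_gt0 TE KE <- TK].
  exact: bound.
have [L_le0|L_gt0] := leP L 0.
  (* With [L <= 0], expansion and the Lipschitz bound leave a single point in the space. *)
  have collapse x : x = xs.
    apply/subr0_eq/dot_eq0; rewrite -sqr_norm2; apply/eqP; rewrite sqrf_eq0.
    have := le_trans (expand x xs) (lip x xs); have := norm2_ge0 (x - xs).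
    rewrite le_eqVlt => /predU1P[<-//|nx].
    by rewrite ler_pM2r// leNgt (le_lt_trans L_le0).
  rewrite /eps_optimal /expect big1 ?ltW// => wx _.
  by rewrite (collapse wx.2) subrr mulr0.
have T_ge : 96 * (L / mu) <= T%:R.
  by have := ceil_ge (96 * (L / mu)); rewrite -TE.
have T_gt0 : (0 < T)%N.
  by rewrite -(ltr0n R) (lt_le_trans _ T_ge)// mulr_gt0// divr_gt0.
have L_neq0 : L != 0 by rewrite gt_eqF.
have eta_gt0 : 0 < 1 / (16 * L) by rewrite divr_gt0// mulr_gt0.
have eta_lt : 1 / (16 * L) < (4 * L)^-1.
  by rewrite div1r ltf_pV2 ?posrE ?mulr_gt0// ltr_pM2r// ltr_nat.
apply: le_trans (bound _ _ _ eta_gt0 eta_lt T_gt0 TK) _.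
(* The first summand is 64 kappa / (3 T) <= 2/9 since T >= 96 kappa, the second (T + 1) / (3 T) <=
   2/3 since T >= 1. *)
have rate_le : rate L mu (1 / (16 * L)) T <= 8 / 9.
  have T1 : 1 <= T%:R :> R by rewrite ler1n.
  have b34 : 1 - 4 * L * (1 / (16 * L)) = 3 / 4 by field.
  have h1 : 1 / (mu * (1 / (16 * L)) * (3 / 4) * T%:R) <= 2 / 9.
    have -> : 1 / (mu * (1 / (16 * L)) * (3 / 4) * T%:R) = 2 / 9 * (96 * (L / mu)) / T%:R.
      by field; rewrite !gt_eqF// ltr0n.
    by rewrite ler_pdivrMr ?ltr0n// ler_pM2l.
  have h2 : 4 * L * (1 / (16 * L)) * (T%:R + 1) / (3 / 4 * T%:R) <= 2 / 3.
    have -> : 4 * L * (1 / (16 * L)) = 1 / 4 by field.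
    by rewrite ler_pdivrMr ?mulr_gt0 ?ltr0n//; lra.
  by rewrite /rate b34; lra.
have gap0 := gap_ge0 hmin x0.
have K_bound : (8 / 9) ^+ K * gap f xs x0 <= eps.
  (* A zero initial gap is treated apart, as the logarithm carries information only for a positive
     gap. *)
  move: gap0; rewrite le_eqVlt => /predU1P[<-|gap_gt0].
    by rewrite mulr0 ltW.
  have ln_gt : 0 < ln (9 / 8) :> R by rewrite ln_gt0//; lra.
  have : 1 / ln (9 / 8) * ln (gap f xs x0 / eps) <= K%:R.
    apply: le_trans (ceil_ge _) _; rewrite -[K%:R]/(K%:Z%:~R) KE ler_int.
    by rewrite le_max lexx orbT.
  rewrite mulrAC mul1r ler_pdivrMr// [leRHS]mulr_natl -lnXn; last by lra.
  rewrite ler_ln ?posrE ?divr_gt0 ?exprn_gt0//.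
  rewrite ler_pdivrMr// => le_pow.
  have -> : 8 / 9 = (9 / 8)^-1 :> R by field.
  by rewrite exprVn ler_pdivrMl// exprn_gt0.
apply: le_trans K_bound; apply: ler_wpM2r => //.
apply: lerXn2r; rewrite ?nnegrE//.
exact: (rate_ge0 L_gt0 eta_gt0 eta_lt mu_gt0).
Qed.
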